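(* Let $\mathbf A\in G^n$ be an element of type $(h,t)$ with $h\ge2$, and let $\mathbf A=\mathbf A_1\mathbf A_2$ be its canonical decomposition. Write $H(\mathbf A)=H(\mathbf A_1)=\{a_1,\ldots,a_h\}$ and $d_i=\mathrm{ord}(a_i)>1$ for $1\le i\le h$, and let $\ell(\mathbf A)$ be the least common multiple of $d_1,\ldots,d_h$. Then: (a) $N(\mathbf A_1)\le\binom{\ell(\mathbf A)+h-1}{h-1}-h$ and, in particular, $|S_{\mathbf A}|\le\binom{\ell(\mathbf A)+h-1}{h-1}+n-h$. (b) $N(\mathbf A_1)=\binom{\ell(\mathbf A)+h-1}{h-1}-h$ if and only if $H(\mathbf A)=H(\mathbf A_1)=\{\theta,\theta,\ldots,\theta\}$ (that is, $a_1=\cdots=a_h=\theta$), where $\theta$ is an element of order $\ell(\mathbf A)$ in $\mathbb F_q^*$.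
   Context: $\mathbb F_q$ is the finite field with $q$ elements, $q$ a power of a prime $p$; $n\ge1$; $\mathbb N$ contains $0$; $\mathrm{ord}(a)$ is the multiplicative order of $a\in\mathbb F_q^*$. $G\le \mathrm{GL}_2(\mathbb F_q)$ is the group of matrices $\begin{pmatrix}a&b\\0&1\end{pmatrix}$ with $a\ne0$, and $G^n$ is the direct product of $n$ copies. An element of $G$ is of $h$-type if it equals $\begin{pmatrix}a&0\\0&1\end{pmatrix}$ with $a\neq0,1$, and of $t$-type if it equals $\begin{pmatrix}1&1\\0&1\end{pmatrix}$. For nonnegative integers $h,t$ with $h+t\le n$, $\mathbf A=(A_1,\ldots,A_n)\in G^n$ is of type $(h,t)$ if its first $h$ coordinates are of $h$-type, the following $t$ are of $t$-type and the remaining $n-h-t$ are the identity matrix. $H(\mathbf A)=\{a_1,\ldots,a_h\}$ is the ordered list (repetitions allowed) of the upper-left entries of the first $h$ coordinates. The canonical decomposition $\mathbf A=\mathbf A_1\mathbf A_2$ is the one in which $\mathbf A_1=(A_1,\ldots,A_h,I,\ldots,I)$ (of type $(h,0)$) and $\mathbf A_2=\mathbf A_1^{-1}\mathbf A$. $M_{\mathbf A_1}$ is the set of monomials $x_1^{b_1}\cdots x_h^{b_h}$ with $(b_1,\ldots,b_h)\in\mathbb N^h$ nonzero, $b_i\le d_i$ for all $i$, and $a_1^{b_1}\cdots a_h^{b_h}=1$; $M_{\mathbf A_1}^*$ is the set of monomials in $M_{\mathbf A_1}$ not divisible by any other element of $M_{\mathbf A_1}$. $N(\mathbf A_1):=|M_{\mathbf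 A_1}^*|-h$. $S_{\mathbf A}:=M_{\mathbf A_1}^*\cup L(h,t)\cup V_{h+t}\subseteq\mathbb F_q[x_1,\ldots,x_n]$, where $L(h,0)=\emptyset$, $L(h,1)=\{x_{h+1}^p-x_{h+1}\}$, for $t\ge2$, $L(h,t)=\{x_{h+1}-x_{h+2},\ldots,x_{h+t-1}-x_{h+t},\,x_{h+t}^p-x_{h+t}\}$, and $V_n=\emptyset$, $V_d=\{x_{d+1},\ldots,x_n\}$ for $0\le d\le n-1$. *)

(* Defs.v *)
From HB Require Import structures.
From mathcomp Require Import all_boot all_order all_fingroup all_algebra.
From mathcomp Require Import finmap.
From mathcomp.multinomials Require Import mpoly.

Set Implicit Arguments.
Unset Strict Implicit.
Unset Printing Implicit Defensive.

Import GRing.Theory.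

Local Open Scope ring_scope.

(* Coordinates and variables are indexed from 0: the coordinate A_(i+1) of a  *)
(* tuple is A i and the variable x_(i+1) is 'X_i, for i : 'I_n.               *)

Section Affine.
Variable F : finFieldType.

Definition affmx (a b : F) : 'M[F]_2 :=
  \matrix_(i, j) if i == 0 then (if j == 0 then a else b) else (j == 1)%:R.

Definition Aff : {set {'GL_2[F]}} :=
  [set g : {'GL_2[F]} | [exists a : F, exists b : F,
              (a != 0) && (GLval g == affmx a b)]].

Lemma Aff_group_set : group_set Aff.
Proof.
apply/group_setP; split.
  rewrite inE; apply/existsP; exists 1; apply/existsP; exists 0.
  rewrite oner_eq0 /=; apply/eqP/matrixP=> i j; rewrite !mxE.
  by case: i => -[|[|[]]] //= ?; case: j => -[|[|[]]].
move=> x y; rewrite !inE => /existsP[a /existsP[b /andP[a0 /eqP ea]]].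
move=> /existsP[c /existsP[d /andP[c0 /eqP ec]]].
apply/existsP; exists (a * c); apply/existsP; exists (a * d + b).
rewrite mulf_neq0 //=; apply/eqP.
change (GLval x *m GLval y = affmx (a * c) (a * d + b)).
rewrite ea ec; apply/matrixP=> i j; rewrite !mxE big_ord_recl big_ord1 !mxE.
by case: i => -[|[|[]]] //= ?; case: j => -[|[|[]]] //= ?;
  rewrite ?(mulr0, mul0r, addr0, add0r, mulr1, mul1r).
Qed.

Canonical Aff_group := Group Aff_group_set.

Definition is_htype (g : {'GL_2[F]}) : bool :=
  [exists a : F, [&& a != 0, a != 1 & GLval g == affmx a 0]].

Definition is_ttype (g : {'GL_2[F]}) : bool := GLval g == affmx 1 1.

(* Multiplicative order in F^*; the value at a = 0 is the junk value 1. *)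
Definition ordF (a : F) : nat := #[insubd (1%g : {unit F}) a]%g.

End Affine.

Local Open Scope fset_scope.

Section Invariants.
Variables (F : finFieldType) (n : nat).

(* Pointwise product of n copies of GL_2(F) (group structure of gproduct). *)
Definition GLn : finGroupType := {dffun forall i : 'I_n, {'GL_2[F]}}.

Definition Gn : {set GLn} := setXn (fun _ : 'I_n => Aff F).

Implicit Types (h t d p : nat) (A : GLn) (i : 'I_n).

Definition has_type h t A : Prop :=
  [/\ (h + t <= n)%N,
      forall i, (i < h)%N -> is_htype (A i),
      forall i, (h <= i < h + t)%N -> is_ttype (A i) &
      forall i, (h + t <= i)%N -> A i = 1%g].

Definition canonical1 h A : GLn :=
  [ffun i : 'I_n => if (i < h)%N then A i else 1%g].

Definition canonical_decomposition h A A1 A2 : Prop :=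
  A1 = canonical1 h A /\ A2 = (A1^-1 * A)%g.

Definition ul A i : F := GLval (A i) 0 0.

Definition Hlist h A : seq F := [seq ul A i | i <- enum 'I_n & (i < h)%N].

Definition ell h A : nat := \big[lcmn/1%N]_(i < n | (i < h)%N) ordF (ul A i).

(* Exponent bound: d_i for the first h variables, and 0 for the others, which *)
(* do not occur in the monomials considered.                                  *)
Definition expbound h A i : nat := if (i < h)%N then ordF (ul A i) else 0%N.

Definition Mset h A : {fset 'X_{1..n}} :=
  [fset m in [fset [multinom (b i : nat) | i < n]
               | b : {dffun forall i : 'I_n, 'I_(expbound h A i).+1} in predT]
     | (m != 0%MM) && (\prod_(i < n | (i < h)%N) ul A i ^+ m i == 1)].

(* (m' <= m)%MM is the divisibility of 'X_[m] by 'X_[m']. *)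
Definition Mstar h A : {fset 'X_{1..n}} :=
  [fset m in Mset h A
     | [forall m' : Mset h A, (val m' != m) ==> ~~ (val m' <= m)%MM]].

Definition NA h A : int := #|` Mstar h A|%:Z - h%:Z.

Definition Lset p h t : {fset {mpoly F[n]}} :=
  if t is 0 then fset0 else
  [fset 'X_u.1 - 'X_u.2
     | u in [pred u : 'I_n * 'I_n |
               [&& (h <= u.1)%N, u.1.+1 == u.2 :> nat & (u.2 < h + t)%N]]]
  `|` [fset 'X_i ^+ p - 'X_i | i in [pred i : 'I_n | i.+1 == (h + t)%N]].

Definition Vset d : {fset {mpoly F[n]}} :=
  [fset 'X_i | i in [pred i : 'I_n | (d <= i)%N]].

Definition Sset p h t A : {fset {mpoly F[n]}} :=
  [fset 'X_[m] | m in Mstar h (canonical1 h A)]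
  `|` Lset p h t `|` Vset (h + t).

End Invariants.

(* Main.v *)
(* The minimal monomials form an antichain for divisibility, of degrees at most
   l = ell(A): a longer relation would, by the pigeonhole principle on prefix
   products among the l-th roots of unity, contain a shorter one. Fixing a
   variable x_j and padding every minimal monomial to degree l with powers of x_j
   is injective, which gives the bound by the number of monomials of degree l in
   h variables. In case of equality the padding is surjective for every j, which
   forces x_i^l and x_i^(l-1) x_j to be minimal, i.e. ord(a_i) = l and
   a_i = a_j. *)

Require Import Defs.
From mathcomp Require Import all_boot all_order all_fingroup all_algebra.
From mathcomp Require Import finmap.
From mathcomp.multinomials Require Import mpoly.
From mathcomp Require Import cyclic zify.

Set Implicit Arguments.
Unset Strict Implicit.
Unset Printing Implicit Defensive.

Import Order.TTheory GRing.Theory Num.Theory.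
Local Open Scope ring_scope.
Local Open Scope fset_scope.

(** * Counts of indices and degrees of monomials *)

Lemma card_ord_lt n h : (h <= n)%N -> #|[pred i : 'I_n | (i < h)%N]| = h.
Proof.
by move=> hn; rewrite -sum1_card -(big_ord_widen _ (fun=> 1%N)) // sum1_card
  card_ord.
Qed.

Lemma card_ord_itv n a b : (a <= b <= n)%N ->
  #|[pred i : 'I_n | (a <= i < b)%N]| = (b - a)%N.
Proof.
move=> /andP[ab bn]; have an := leq_trans ab bn.
rewrite -{2}(card_ord_lt bn) -{2}(card_ord_lt an).
rewrite -(cardID [pred i : 'I_n | (i < a)%N] [pred i : 'I_n | (i < b)%N]).
rewrite [X in (X + _ - _)%N](_ : _ = #|[pred i : 'I_n | (i < a)%N]|).
  by rewrite addKn; apply: eq_card => i; rewrite !inE -leqNgt.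
by apply: eq_card => i; rewrite !inE andbC; case: ltnP => //= /leq_trans->.
Qed.

(** The quotient of the two monomials has degree 0, hence is trivial. This settles minimality in the
    equality case. *)
Lemma lem_mdeg_eq n (m m' : 'X_{1..n}) :
  (m <= m')%MM -> (mdeg m' <= mdeg m)%N -> m = m'.
Proof.
move=> le_mm'; rewrite -(submK le_mm') mdegD -{2}[mdeg m]add0n leq_add2r leqn0.
by rewrite mdeg_eq0 => /eqP ->; rewrite add0m.
Qed.

Lemma leq_mnm_mdeg n (m : 'X_{1..n}) i : (m i <= mdeg m)%N.
Proof. by rewrite mdegE (bigD1 i) //= leq_addr. Qed.

Lemma mdeg_s2m n (s : seq 'I_n) : mdeg (s2m s) = size s.
Proof.
elim: s => [|i s IHs]; first by rewrite mdegE big1 // => i _; rewrite mnmE.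
rewrite -[RHS]/((size s).+1) -IHs -add1n -(mdeg1 i) -mdegD; congr mdeg.
by apply/mnmP => j; rewrite mnmDE mnm1E !mnmE.
Qed.

(** * Short relations among roots of unity *)

(* Among the ell + 1 prefix products of a factorisation of the monomial two
   agree, since they are all ell-th roots of unity; their quotient is the value
   of a consecutive block of at most ell factors. *)
Lemma exists_submonomial_eq1 (R : fieldType) n (a : 'I_n -> R) ell
    (m : 'X_{1..n}) : (0 < ell)%N -> (ell <= mdeg m)%N ->
    (forall i, (0 < m i)%N -> a i ^+ ell = 1) ->
  exists m' : 'X_{1..n}, [/\ (m' <= m)%MM, m' != 0%MM, (mdeg m' <= ell)%N
                          & \prod_i a i ^+ m' i = 1].
Proof.
move=> ell_gt0 le_ell a_ell.
pose s := m2s m; have sz_s : size s = mdeg m by rewrite size_m2s.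
pose pm k := s2m (take k s); pose P k := \prod_i a i ^+ pm k i.
have pmS k k' : (k <= k')%N -> (pm k <= pm k')%MM.
  move=> kk'; apply/mnm_lepP => i; rewrite !mnmE -(take_takel s kk').
  by rewrite -{2}(cat_take_drop k (take k' s)) count_cat leq_addr.
have pm_m k : (pm k <= m)%MM.
  rewrite -[X in (_ <= X)%MM]s2mK; apply/mnm_lepP => i; rewrite !mnmE.
  by rewrite -[m2s m](cat_take_drop k) count_cat leq_addr.
have deg_pm k : (k <= ell)%N -> mdeg (pm k) = k.
  by move=> kell; rewrite mdeg_s2m size_takel // sz_s (leq_trans kell).
(* The hypothesis covers only the variables dividing [m]; every other variable has exponent 0 in
   each prefix. *)
have P_ell k : P k ^+ ell = 1.
  rewrite -prodrXl big1 // => i _; rewrite exprAC.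
  case: (posnP (m i)) => [mi0|/a_ell ->]; last by rewrite expr1n.
  have /mnm_lepP/(_ i) := pm_m k; rewrite mi0 leqn0 => /eqP ->.
  by rewrite expr0.
have P_neq0 k : P k != 0.
  apply: contra_eq_neq (P_ell k) => ->.
  by rewrite expr0n eqn0Ngt ell_gt0 eq_sym oner_eq0.
have /injectivePn[x0 [y0 neq_xy eqP_xy]] :
    ~~ injectiveb (fun k : 'I_ell.+1 => P k).
  apply/negP => /(max_unity_roots ell_gt0); rewrite size_codom card_ord ltnn.
  suff -> : all ell.-unity_root (codom (fun k : 'I_ell.+1 => P k)) by move/(_ isT).
  by apply/allP => _ /codomP[k ->]; apply/unity_rootP.
have [x [y [lt_xy le_y eqP]]] :
    exists x y : nat, [/\ (x < y)%N, (y <= ell)%N & P x = P y].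
  have [lt|gt|/val_inj eq] := ltngtP x0 y0; last by rewrite eq eqxx in neq_xy.
    by exists x0, y0; split=> //; rewrite -ltnS.
  by exists y0, x0; split=> //; rewrite -ltnS.
have le_x := ltnW (leq_trans lt_xy le_y).
have le_pm := pmS _ _ (ltnW lt_xy).
have deg_q : mdeg (pm y - pm x)%MM = (y - x)%N.
  by rewrite -{2}(deg_pm y) // -{2}(deg_pm x) // -{2}(submK le_pm) mdegD addnK.
exists (pm y - pm x)%MM; split.
- exact: lepm_trans (lem_subr _ _) (pm_m y).
- by rewrite -mdeg_eq0 deg_q -lt0n subn_gt0.
- by rewrite deg_q (leq_trans (leq_subr _ _)).
apply: (mulIf (P_neq0 x)); rewrite mul1r {2}eqP -big_split /=.
by apply: eq_bigr => i _; rewrite -exprD -mnmDE submK.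
Qed.

(** * Monomials of fixed degree and padding of antichains *)

(** Exponent vectors are tuples over ['I_d.+1] of sum [d], the form counted by
    [card_ord_partitions]. *)
Definition hmonomials n h d : {fset 'X_{1..n}} :=
  [fset [multinom if (i < h)%N then val (nth ord0 t i) else 0%N | i < n]
     | t : h.-tuple 'I_d.+1 in
         [pred t : h.-tuple 'I_d.+1 | (\sum_(i <- t) i == d)%N]].

Lemma sum_ord_lt n h (f : nat -> nat) : (h <= n)%N ->
  (\sum_(i < n) (if (i < h)%N then f i else 0) = \sum_(i < h) f i)%N.
Proof.
by move=> hn; rewrite (big_ord_widen n f hn) [RHS]big_mkcond.
Qed.

Lemma mem_hmonomials n h d (m : 'X_{1..n}) : (h <= n)%N ->
  reflect (mdeg m = d /\ forall i : 'I_n, (h <= i)%N -> m i = 0%N)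
          (m \in hmonomials n h d).
Proof.
move=> hn; apply: (iffP (imfsetP _ _ _ _)) => [[t /= /eqP sum_t ->]|[deg_m m0]].
  split=> [|i]; last by rewrite mnmE ltnNge => ->.
  rewrite mdegE (eq_bigr (fun i : 'I_n =>
     if (i < h)%N then val (nth ord0 t i) else 0%N)); last first.
    by move=> i _; rewrite mnmE.
  rewrite (sum_ord_lt (fun i => val (nth ord0 t i)) hn).
  apply: etrans sum_t; rewrite big_tuple.
  by apply: eq_bigr => i _; rewrite (tnth_nth ord0).
(* No exponent exceeds the degree [d], so [inord] never takes its default value. *)
pose t := [tuple inord (nth 0%N m i) : 'I_d.+1 | i < h].
have tE (i : 'I_n) : (i < h)%N -> val (nth ord0 t i) = m i.
  move=> ih; rewrite -(tnth_nth _ _ (Ordinal ih)) tnth_mktuple [LHS]inordK /=.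
    by rewrite -mnm_nth.
  by rewrite -mnm_nth ltnS -deg_m leq_mnm_mdeg.
have mE : m = [multinom if (i < h)%N then val (nth ord0 t i) else 0%N | i < n].
  by apply/mnmP => i; rewrite mnmE; case: ltnP => [/tE|/m0].
exists t => //=; apply/eqP/(etrans _ deg_m); rewrite big_tuple mdegE.
rewrite -(eq_bigr _ (fun i _ => congr1 (fun m : 'X_{1..n} => m i) (esym mE))).
under [RHS]eq_bigr do rewrite mnmE.
rewrite (sum_ord_lt (fun i => val (nth ord0 t i)) hn).
by apply: eq_bigr => i _; rewrite (tnth_nth ord0).
Qed.

(** Stars and bars; distinct tuples give distinct monomials because all [h.+1] variables exist when
    [h < n]. *)
Lemma card_hmonomials n h d : (h < n)%N ->
  #|` hmonomials n h.+1 d| = 'C(d + h, h).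
Proof.
move=> hn; rewrite card_in_imfset /=; last first.
  move=> t u _ _ /mnmP eq_tu; apply: eq_from_tnth => i.
  have := eq_tu (widen_ord hn i); rewrite !mnmE /= ltn_ord => /val_inj.
  by rewrite !(tnth_nth ord0).
rewrite -cardE addnC -card_ord_partitions.
by apply: eq_card => t; rewrite !inE.
Qed.

(* Padding all the monomials of an antichain to degree d with powers of one
   fixed variable is injective, because two monomials with the same padding are
   comparable. *)
Lemma antichain_padding n h d (j : 'I_n) (T : {fset 'X_{1..n}}) :
    (h <= n)%N -> (j < h)%N ->
    (forall m, m \in T -> (mdeg m <= d)%N) ->
    (forall m (i : 'I_n), m \in T -> (h <= i)%N -> m i = 0%N) ->
    (forall m m', m \in T -> m' \in T -> (m <= m')%MM -> m = m') ->
  (#|` T| <= #|` hmonomials n h d|)%N /\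
  (#|` T| = #|` hmonomials n h d| ->
   forall w, w \in hmonomials n h d ->
     exists2 m, m \in T & w = (m + U_(j) *+ (d - mdeg m))%MM).
Proof.
move=> hn jh T_deg T_supp T_anti; pose f m := (m + U_(j) *+ (d - mdeg m))%MM.
have cardf : #|` f @` T| = #|` T|.
  apply: card_in_imfset => m m' /= mT m'T eq_f.
  (* Padding changes only the exponent of $x_j$, so [m] and [m'] agree elsewhere and comparing their
     exponents at [j] makes them comparable. *)
  wlog le_mm' : m m' mT m'T eq_f / (m j <= m' j)%N.
    by move=> W; case/orP: (leq_total (m j) (m' j)) => [/W|/W/esym]; apply.
  apply: T_anti => //; apply/mnm_lepP => i; have [-> //|ne_ij] := eqVneq i j.
  have /mnmP/(_ i) := eq_f; rewrite !mnmDE !mulmnE !mnm1E eq_sym (negPf ne_ij).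
  by rewrite !mul0n !addn0 => ->.
have sub_f : f @` T `<=` hmonomials n h d.
  apply/fsubsetP => _ /imfsetP[m /= mT ->]; apply/mem_hmonomials => //.
  split=> [|i hi]; first by rewrite mdegD mdegMn mdeg1 mul1n subnKC ?T_deg.
  rewrite mnmDE T_supp // mulmnE mnm1E (_ : (j == i) = false) //.
  by apply: contraTF jh => /eqP ->; rewrite -leqNgt.
split; first by rewrite -cardf fsubset_leq_card.
move=> cardT w; have /eqP <- : f @` T == hmonomials n h d.
  by rewrite eqEfcard sub_f cardf cardT leqnn.
by case/imfsetP => m /= mT ->; exists m.
Qed.

(** * Orders in the multiplicative group of the field *)

Section MultiplicativeOrder.
Variable F : finFieldType.

Lemma ordF_dvd (a : F) k : a != 0 -> (a ^+ k == 1) = (ordF a %| k)%N.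
Proof.
move=> a0; rewrite /ordF order_dvdn -val_eqE /= FinRing.val_unitX.
by rewrite insubdK // unitfE.
Qed.

Lemma ordF_val (u : {unit F}) : ordF (val u) = #[u]%g.
Proof. by rewrite /ordF valKd. Qed.

Lemma ordF_gt1 (a : F) : a != 0 -> a != 1 -> (1 < ordF a)%N.
Proof.
move=> a0; apply: contraNltn; rewrite leq_eqVlt ltnS leqn0.
case/orP => [/eqP ord1|]; last by rewrite eqn0Ngt order_gt0.
by rewrite -[a]expr1 ordF_dvd // ord1.
Qed.

End MultiplicativeOrder.

(** * Minimal monomials: degree, number and equality case *)

Section MinimalMonomials.
Variables (F : finFieldType) (n h : nat) (A : GLn F n).
Hypothesis A_neq0 : forall i : 'I_n, (i < h)%N -> ul A i != 0.

Local Notation a := (ul A).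
Local Notation l := (ell h A).

Lemma ell_gt0 : (0 < l)%N.
Proof.
apply: (big_ind (fun k => (0 < k)%N)) => // [x y x0 y0|i _].
  by rewrite lcmn_gt0 x0.
exact: order_gt0.
Qed.

Lemma ordF_dvd_ell (i : 'I_n) : (i < h)%N -> (ordF (a i) %| l)%N.
Proof. by move=> ih; rewrite /ell (bigD1 i) //= dvdn_lcml. Qed.

(** The product may run over all indices, since the exponents beyond the first [h] are 0. *)
Lemma mem_Mset (m : 'X_{1..n}) :
  reflect [/\ m != 0%MM, forall i, (m i <= expbound h A i)%N
            & \prod_i a i ^+ m i = 1]
          (m \in Mset h A).
Proof.
have prodE : (forall i, (m i <= expbound h A i)%N) ->
    \prod_(i < n | (i < h)%N) a i ^+ m i = \prod_i a i ^+ m i.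
  move=> le_m; rewrite big_mkcond; apply: eq_bigr => i _.
  by move: (le_m i); rewrite /expbound; case: ltnP => // _; case: (m i).
rewrite /Mset !inE /=; apply: (iffP and3P).
  case=> /imfsetP[b /= _ mE] m0 /eqP prod1.
  have le_m i : (m i <= expbound h A i)%N by rewrite mE mnmE -ltnS ltn_ord.
  by split=> //; rewrite -prodE.
case=> m0 le_m prod1; split=> //; last by rewrite prodE // prod1.
apply/imfsetP; exists [ffun i => inord (m i)] => //=.
by apply/mnmP => i; rewrite mnmE ffunE inordK // ltnS.
Qed.

Lemma mem_Mstar (m : 'X_{1..n}) :
  reflect (m \in Mset h A /\
           forall m', m' \in Mset h A -> (m' <= m)%MM -> m' = m)
          (m \in Mstar h A).
Proof.
rewrite /Mstar !inE /=; apply: (iffP andP) => -[mM min_m]; split=> //.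
  move=> m' m'M le_m'; apply/eqP.
  by have /forallP/(_ [` m'M]) := min_m; apply: contraTT => /= ->; rewrite le_m'.
apply/forallP => -[m' m'M] /=; apply/implyP; apply: contraNN => /min_m.
by move=> /(_ m'M) ->.
Qed.

Lemma mem_Mset_support (m : 'X_{1..n}) (i : 'I_n) :
  m \in Mset h A -> (h <= i)%N -> m i = 0%N.
Proof.
case/mem_Mset => _ le_m _ hi; move: (le_m i).
by rewrite /expbound ltnNge hi leqn0 => /eqP.
Qed.

(** Divisors inherit the exponent bounds, so only nontriviality and the relation itself remain to be
    checked. *)
Lemma mem_Mset_sub (m m' : 'X_{1..n}) :
  m \in Mset h A -> (m' <= m)%MM -> m' != 0%MM -> \prod_i a i ^+ m' i = 1 ->
  m' \in Mset h A.
Proof.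
case/mem_Mset => _ le_m _ /mnm_lepP le_m' m'0 prod1; apply/mem_Mset.
by split=> // i; apply: leq_trans (le_m i).
Qed.

(** In degree above [l], the relation of degree at most [l] given by [exists_submonomial_eq1] would
    be a proper divisor in [Mset]. *)
Lemma Mstar_mdeg (m : 'X_{1..n}) : m \in Mstar h A -> (mdeg m <= l)%N.
Proof.
case/mem_Mstar => mM min_m; rewrite leqNgt; apply/negP => lm.
have a_l i : (0 < m i)%N -> a i ^+ l = 1.
  move=> mi_gt0; have ih : (i < h)%N.
    by apply: contraLR mi_gt0; rewrite -leqNgt => /(mem_Mset_support mM) ->.
  by apply/eqP; rewrite ordF_dvd ?ordF_dvd_ell ?A_neq0.
have [m' [le_m' m'0 deg_m' prod1]] := exists_submonomial_eq1 ell_gt0 (ltnW lm) a_l.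
by move: lm; rewrite -(min_m m') // ?ltnNge ?deg_m' // (mem_Mset_sub mM).
Qed.

Lemma Mstar_padding (j : 'I_n) : (h <= n)%N -> (j < h)%N ->
  (#|` Mstar h A| <= #|` hmonomials n h l|)%N /\
  (#|` Mstar h A| = #|` hmonomials n h l| ->
   forall w, w \in hmonomials n h l ->
     exists2 m, m \in Mstar h A & w = (m + U_(j) *+ (l - mdeg m))%MM).
Proof.
move=> hn jh; apply: antichain_padding => //.
- exact: Mstar_mdeg.
- by move=> m i /mem_Mstar[mM _]; apply: mem_Mset_support.
by move=> m m' /mem_Mstar[mM _] /mem_Mstar[_ min_m'] /(min_m' _ mM).
Qed.

Lemma prod_exp2 (i j : 'I_n) k k' : i != j ->
  \prod_i0 a i0 ^+ (U_(i) *+ k + U_(j) *+ k')%MM i0 = a i ^+ k * a j ^+ k'.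
Proof.
move=> ne_ij; rewrite (bigD1 i) //= (bigD1 j) 1?eq_sym //= big1 => [|o].
  rewrite !mnmDE !mulmnE !mnm1E !eqxx eq_sym (negPf ne_ij).
  by rewrite !mul1n !mul0n addn0 mulr1.
case/andP=> oi oj; rewrite mnmDE !mulmnE !mnm1E ![_ == o]eq_sym.
by rewrite (negPf oi) (negPf oj).
Qed.

(* Padding with x_j shows that x_i^l is a minimal monomial, hence ord(a_i) = l,
   and that so is x_i^(l-1) x_j: otherwise x_i^(l-1) would be. *)
Lemma card_Mstar_max_eq (i j : 'I_n) :
    (h <= n)%N -> (forall i : 'I_n, (i < h)%N -> a i != 1) ->
    #|` Mstar h A| = #|` hmonomials n h l| ->
    (i < h)%N -> (j < h)%N -> i != j ->
  ordF (a i) = l /\ a i = a j.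
Proof.
move=> hn a_neq1 cardM ih jh ne_ij.
have [_ /(_ cardM) padj] := Mstar_padding hn jh.
have ai1 := ordF_gt1 (A_neq0 ih) (a_neq1 i ih).
have l1 : (1 < l)%N := leq_trans ai1 (dvdn_leq ell_gt0 (ordF_dvd_ell ih)).
have mon_hmon k k' : (k + k')%N = l ->
    (U_(i) *+ k + U_(j) *+ k')%MM \in hmonomials n h l.
  move=> kl; apply/mem_hmonomials => //; split=> [|o ho].
    by rewrite mdegD !mdegMn !mdeg1 !mul1n.
  rewrite mnmDE !mulmnE !mnm1E.
  have [io|_] := eqVneq i o; first by rewrite -io leqNgt ih in ho.
  by have [jo|//] := eqVneq j o; rewrite -jo leqNgt jh in ho.
(* The monomial $x_i^k x_j^{k'}$ is the padding of a minimal one, which can differ from it only by a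
   smaller exponent [s] of $x_j$. *)
have padded k k' : (k + k')%N = l -> exists2 s, (s <= k')%N &
    (U_(i) *+ k + U_(j) *+ s)%MM \in Mset h A.
  move=> kl; have [m /mem_Mstar[mM _] wE] := padj _ (mon_hmon _ _ kl).
  have mE o : m o = ((U_(i) *+ k + U_(j) *+ k')%MM o - (j == o) * (l - mdeg m))%N.
    by rewrite wE mnmDE mulmnE mnm1E addnK.
  exists (k' - (l - mdeg m))%N; first exact: leq_subr.
  suff <- : m = (U_(i) *+ k + U_(j) *+ (k' - (l - mdeg m)))%MM by [].
  apply/mnmP => o; rewrite mE !mnmDE !mulmnE !mnm1E.
  have [<-|_] := eqVneq j o; last by rewrite !mul0n subn0.
  by rewrite (negPf ne_ij) !mul1n.
have ord_i : ordF (a i) = l.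
  (* Here [s] is 0, so $x_i^l$ lies in [Mset] and the exponent bound gives $l \le d_i$. *)
  have [s] := padded l 0%N (addn0 _); rewrite leqn0 => /eqP -> /mem_Mset[_ le_m _].
  apply/eqP; rewrite eqn_leq (dvdn_leq ell_gt0 (ordF_dvd_ell ih)) /=.
  move: (le_m i); rewrite /expbound ih mnmDE !mulmnE !mnm1E eqxx eq_sym.
  by rewrite muln0 addn0 mul1n.
(* If [s] is 1, then $a_i^{l-1}a_j = 1 = a_i^l$ and $a_i$ cancels to $a_j$. If [s] is 0, then $l$
   divides $l-1$, which is positive as $l>1$. *)
split=> //; have [s] := padded l.-1 1%N ltac:(by rewrite addn1 prednK // ell_gt0).
rewrite leq_eqVlt ltnS leqn0 => /orP[]/eqP -> /mem_Mset[_ _].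
  rewrite prod_exp2 // expr1 => aij; apply: (mulfI (expf_neq0 l.-1 (A_neq0 ih))).
  rewrite aij -exprSr prednK ?ell_gt0 //.
  by apply/eqP; rewrite ordF_dvd ?A_neq0 // ord_i.
rewrite prod_exp2 // expr0 mulr1 => /eqP; rewrite ordF_dvd ?A_neq0 // ord_i.
by move/dvdn_leq; rewrite -subn1 => /(_ ltac:(lia)); lia.
Qed.

(** When all $a_i$ equal $\theta$, a monomial takes the value $\theta$ to its degree, so relations
    are the monomials of degree divisible by [l], and those of degree exactly [l] are minimal. *)
Lemma hmonomials_sub_Mstar (theta : {unit F}) : (h <= n)%N ->
    (forall i : 'I_n, (i < h)%N -> a i = val theta) -> #[theta]%g = l ->
  hmonomials n h l `<=` Mstar h A.
Proof.
move=> hn a_theta ord_theta.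
have theta0 : val theta != 0 by rewrite -unitfE (valP theta).
have prodE (m : 'X_{1..n}) : (forall i : 'I_n, (h <= i)%N -> m i = 0%N) ->
    (\prod_i a i ^+ m i == 1) = (l %| mdeg m)%N.
  move=> m0; rewrite -ord_theta -ordF_val -ordF_dvd // mdegE -prodrXr.
  congr (_ == _); apply: eq_bigr => i _.
  by case: (ltnP i h) => [/a_theta ->|/m0 ->].
apply/fsubsetP => w /mem_hmonomials => /(_ hn)[deg_w w0].
have wM : w \in Mset h A.
  apply/mem_Mset; split.
  - by rewrite -mdeg_eq0 deg_w -lt0n ell_gt0.
  - move=> i; rewrite /expbound; case: ltnP => [ih|/w0 -> //].
    by rewrite a_theta // ordF_val ord_theta -deg_w leq_mnm_mdeg.
  by apply/eqP; rewrite prodE // deg_w.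
apply/mem_Mstar; split=> // m' m'M le_m'; apply: lem_mdeg_eq => //.
have /mem_Mset[m'0 _ /eqP] := m'M; rewrite prodE => [|i]; last first.
  exact: mem_Mset_support.
by rewrite deg_w => /dvdn_leq; apply; rewrite lt0n mdeg_eq0.
Qed.

End MinimalMonomials.

(** * Sizes of the remaining parts of $S_{\mathbf A}$ *)

(** For $t\ge1$ there are at most $t-1$ differences, each determined by its first index, and one
    polynomial $x^p-x$. *)
Lemma card_Lset (F : finFieldType) n p h t : (h + t <= n)%N ->
  (#|` Lset F n p h t| <= t)%N.
Proof.
case: t => [|t] htn; first by rewrite cardfs0.
rewrite /Lset cardfsU (leq_trans (leq_subr _ _)) // -[leqRHS]addn1 leq_add //.
  rewrite (leq_trans (leq_imfset_card _ _ _)) //= -cardE.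
  have htn' : (h <= h + t <= n)%N by rewrite leq_addr (leq_trans _ htn) ?leq_add2l.
  rewrite -[leqRHS](addKn h) -(card_ord_itv htn').
  rewrite -(@card_in_image _ _ fst) => [|u v]; last first.
    rewrite !unfold_in /= => /and3P[_ /eqP u12 _] /and3P[_ /eqP v12 _].
    case: u v u12 v12 => [u1 u2] [v1 v2] /= u12 v12 uv1; subst v1.
    by congr (_, _); apply: val_inj; rewrite /= -u12.
  apply/subset_leq_card/subsetP => i /imageP[u]; rewrite !unfold_in /=.
  move=> /and3P[hu /eqP u12 ut] ->.
  by move: ut; rewrite -u12 addnS ltnS hu.
rewrite (leq_trans (leq_imfset_card _ _ _)) //= -cardE.
apply/card_le1_eqP => i j; rewrite !unfold_in /= => /eqP ei /eqP ej.
by apply/val_inj/succn_inj; rewrite ei.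
Qed.

Lemma card_Vset (F : finFieldType) n d : (#|` Vset F n d| <= n - d)%N.
Proof.
rewrite (leq_trans (leq_imfset_card _ _ _)) //= -cardE.
case: (leqP d n) => dn; last first.
  rewrite (eq_card0 (A := _)) // => i; rewrite !inE.
  by apply/negbTE; rewrite -ltnNge (leq_trans (ltn_ord i)) // ltnW.
rewrite -(@card_ord_itv n) ?dn ?leqnn //.
by apply/subset_leq_card/subsetP => i; rewrite !inE ltn_ord andbT.
Qed.

(** * Entries of the tuple and of its canonical part *)

Lemma Hlist_nseqP (F : finFieldType) n h (A : GLn F n) (x : F) : (h <= n)%N ->
  Hlist h A = nseq h x <-> forall i : 'I_n, (i < h)%N -> ul A i = x.
Proof.
move=> hn; have size_H : size (Hlist h A) = h.
  by rewrite size_map -[RHS](card_ord_lt hn) cardE enumT.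
rewrite -{2}size_H; split=> [/all_pred1P/allP allH i ih|a_x].
  by apply/eqP/allH/map_f; rewrite mem_filter ih mem_enum.
apply/all_pred1P/allP => _ /mapP[i + ->]; rewrite mem_filter => /andP[ih _] /=.
by rewrite a_x.
Qed.

Lemma is_htype_ul (F : finFieldType) n (A : GLn F n) (i : 'I_n) :
  is_htype (A i) -> ul A i != 0 /\ ul A i != 1.
Proof. by case/existsP=> a /and3P[a0 a1 /eqP eA]; rewrite /ul eA !mxE. Qed.

Lemma ul_canonical1 (F : finFieldType) n h (A : GLn F n) (i : 'I_n) :
  (i < h)%N -> ul (canonical1 h A) i = ul A i.
Proof. by move=> ih; rewrite /ul ffunE ih. Qed.

Lemma ell_canonical1 (F : finFieldType) n h (A : GLn F n) :
  ell h (canonical1 h A) = ell h A.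
Proof. by apply: eq_bigr => i ih; rewrite ul_canonical1. Qed.

(** * The bounds and the characterization of equality *)

Theorem theorem4p3 (F : finFieldType) (p : nat) (hp : p \in [pchar F])
    (n : nat) (hn : (1 <= n)%N) (h t : nat) (hh : (2 <= h)%N)
    (A A1 A2 : GLn F n) (hA : A \in Gn F n) (htype : has_type h t A)
    (hdec : canonical_decomposition h A A1 A2) :
  (NA h A1 <= 'C(ell h A + h - 1, h - 1)%:Z - h%:Z
   /\ #|` Sset p h t A|%:Z <= 'C(ell h A + h - 1, h - 1)%:Z + n%:Z - h%:Z)
  /\ (NA h A1 = 'C(ell h A + h - 1, h - 1)%:Z - h%:Z
      <-> exists2 theta : {unit F},
            #[theta]%g = ell h A & Hlist h A = nseq h (val theta)).
Proof.
case: htype => htn A_h _ _; case: hdec => -> _.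
have hn' : (h <= n)%N := leq_trans (leq_addr _ _) htn.
set B := canonical1 h A.
have ulB (i : 'I_n) (ih : (i < h)%N) : ul B i = ul A i := ul_canonical1 A ih.
have B_neq0 (i : 'I_n) : (i < h)%N -> ul B i != 0.
  by move=> ih; rewrite ulB //; case: (is_htype_ul (A_h i ih)).
have B_neq1 (i : 'I_n) : (i < h)%N -> ul B i != 1.
  by move=> ih; rewrite ulB //; case: (is_htype_ul (A_h i ih)).
have ellB : ell h B = ell h A := ell_canonical1 h A.
have card_hmon : #|` hmonomials n h (ell h B)| = 'C(ell h A + h - 1, h - 1).
  rewrite ellB; move: (ell h A) => d; case: {+}h hh hn' => // h' _ hn'.
  by rewrite card_hmonomials // addnS !subn1.
have h_gt0 : (0 < h)%N by apply: leq_trans hh.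
(* Since $h\ge2$ there are two distinct indices below [h]. One suffices for the bound; the equality
   case compares pairs. *)
pose i0 : 'I_n := Ordinal (leq_trans h_gt0 hn').
pose i1 : 'I_n := Ordinal (leq_trans hh hn').
have [le_M _] := Mstar_padding B_neq0 hn' (h_gt0 : (i0 < h)%N).
rewrite card_hmon in le_M; rewrite /NA; split; first split.
- by rewrite lerD2r lez_nat.
(* As $h+t\le n$, the last two terms add up to $n-h$. *)
- have le_S : (#|` Sset p h t A| <= #|` Mstar h B| + t + (n - (h + t)))%N.
    rewrite /Sset cardfsU (leq_trans (leq_subr _ _)) // leq_add ?card_Vset //.
    rewrite cardfsU (leq_trans (leq_subr _ _)) // leq_add ?card_Lset //.
    exact: leq_imfset_card.
  lia.
split=> [/addIr[] cardM|[theta ord_theta /Hlist_nseqP H]].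
  rewrite -card_hmon in cardM.
  have [ord0l _] := card_Mstar_max_eq B_neq0 hn' B_neq1 cardM
    (h_gt0 : (i0 < h)%N) (hh : (i1 < h)%N) isT.
  (* The root $\theta$ is $a_1$ viewed as a unit; its order is [ordF] by definition. Every other
     $a_i$ is then compared with $a_1$. *)
  exists (insubd (1%g : {unit F}) (ul A i0)).
    by rewrite -ellB -ord0l ulB.
  apply/Hlist_nseqP => // i ih; rewrite insubdK; last first.
    by rewrite unitfE -ulB ?B_neq0.
  have [->//|ne_i] := eqVneq i i0.
  by have [_] := card_Mstar_max_eq B_neq0 hn' B_neq1 cardM ih
    (h_gt0 : (i0 < h)%N) ne_i; rewrite !ulB.
(* The upper bound is already known, so including all monomials of degree [l] in [Mstar]
   suffices. *)
congr (_%:Z - _); apply/eqP; rewrite eqn_leq le_M -card_hmon.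
apply/fsubset_leq_card/(@hmonomials_sub_Mstar _ _ _ _ theta) => // [i ih|].
  by rewrite ulB ?H.
by rewrite ellB.
Qed.
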